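(* Let $S\subseteq\mathbb{R}^n$. Then $S$ is binary MICP-R if and only if there exist $q,d\in\mathbb{Z}_+$ and nonempty closed convex sets $\tilde S_1,\dots,\tilde S_d\subseteq\mathbb{R}^{n+q}$ (without any restriction on their recession cones) such that $S=\bigcup_{i=1}^d S_i$, where $S_i=\operatorname{proj}_{x}(\tilde S_i)\subseteq\mathbb{R}^n$ is the projection of $\tilde S_i$ onto the first $n$ coordinates. Moreover, for such an $S$ (with such $q$, $d$ and $\tilde S_1,\dots,\tilde S_d$), let $p=q+1$, for each $i\in\{1,\dots,d\}$ let $$T_i=\{(w,w_0)\in\mathbb{R}^{n+q+1} : w\in\tilde S_i,\ \|w\|_2^2\le w_0\},$$ and let $$M=\operatorname{conv}\Big(\bigcup_{i=1}^d \big(T_i\times\{e(d,i)\}\big)\Big)\subseteq\mathbb{R}^{n+p+d},$$ where $e(d,i)\in\mathbb{R}^d$ is the $i$-th standard unit vector. Then for all $x\in\mathbb{R}^n$: $x\in S$ if and only if there exist $y\in\mathbb{R}^p$ and $z\in\mathbb{Z}^d$ with $(x,y,z)\in M$. Furthermore, $M$ is a closed convex set with $\operatorname{proj}_{z}\big(M\cap(\mathbb{R}^{n+p}\times\mathbb{Z}^d)\big)\subseteq\{0,1\}^d$, and hence $M$ induces a binary MICP formulation of $S$.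
   Context: $\mathbb{N}=\{1,2,\dots\}$ and $\mathbb{Z}_+=\{0,1,2,\dots\}$. Let $n\in\mathbb{N}$ and $p,d\in\mathbb{Z}_+$. A closed convex set $M\subseteq\mathbb{R}^{n+p+d}$ (with variables $(x,y,z)\in\mathbb{R}^n\times\mathbb{R}^p\times\mathbb{R}^d$), together with $d$, induces an MICP formulation of $S\subseteq\mathbb{R}^n$ if for every $x\in\mathbb{R}^n$: $x\in S$ if and only if there exist $y\in\mathbb{R}^p$, $z\in\mathbb{Z}^d$ with $(x,y,z)\in M$. The set $S$ is binary MICP-R if for some $p,d\in\mathbb{Z}_+$ there is a closed convex $M\subseteq\mathbb{R}^{n+p+d}$ inducing an MICP formulation of $S$ such that $\operatorname{proj}_z(M\cap(\mathbb{R}^{n+p}\times\mathbb{Z}^d))\subseteq\{0,1\}^d$, where $\operatorname{proj}_z$ is the projection onto the last $d$ coordinates; such an $M$ is said to induce a binary MICP formulation of $S$. In $T_i$ the pair $(w,w_0)\in\mathbb{R}^{n+q+1}$ is identified with $(x,y)\in\mathbb{R}^{n+p}$, the first $n$ coordinates being $x$. *)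

(* Defs.v *)
From mathcomp Require Import all_boot all_order all_algebra.
From mathcomp Require Import all_classical all_reals all_analysis.

Set Implicit Arguments.
Unset Strict Implicit.
Unset Printing Implicit Defensive.

Import Order.TTheory GRing.Theory Num.Theory.
Import numFieldNormedType.Exports.

Local Open Scope classical_set_scope.
Local Open Scope ring_scope.

(* R^k is 'rV[R]_k, with the (product) topology of matrices.  A point (x, y, z)
   of R^(n + p + d) is row_mx (row_mx x y) z; hence proj_x is lsubmx (once the
   last block is gone) and proj_z is rsubmx. *)

Definition conv_hull (R : realType) (k : nat) (A : set 'rV[R]_k) :
    set 'rV[R]_k :=
  smallest (fun C : set 'rV[R]_k => convex_set C) A.

Definition sqnorm2 (R : realType) (k : nat) (w : 'rV[R]_k) : R :=
  \sum_(j < k) w 0 j ^+ 2.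

Definition integer_vec (R : realType) (d : nat) : set 'rV[R]_d :=
  [set z | forall j, z 0 j \is a Num.int].

Definition binary_vec (R : realType) (d : nat) : set 'rV[R]_d :=
  [set z | forall j, z 0 j = 0 \/ z 0 j = 1].

(* The part of M in R^m * Z^d; below m = n + p. *)
Definition integer_slice (R : realType) (m d : nat) (M : set 'rV[R]_(m + d)) :
    set 'rV[R]_(m + d) :=
  M `&` [set v | integer_vec (rsubmx v)].

Definition induces_MICP (R : realType) (n p d : nat)
    (M : set 'rV[R]_(n + p + d)) (S : set 'rV[R]_n) : Prop :=
  [/\ closed M, convex_set M &
      forall x : 'rV[R]_n, S x <->
        exists (y : 'rV[R]_p) (z : 'rV[R]_d),
          integer_vec z /\ M (row_mx (row_mx x y) z)].

Definition induces_binary_MICP (R : realType) (n p d : nat)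
    (M : set 'rV[R]_(n + p + d)) (S : set 'rV[R]_n) : Prop :=
  induces_MICP M S /\ rsubmx @` integer_slice M `<=` @binary_vec R d.

Definition binary_MICP_R (R : realType) (n : nat) (S : set 'rV[R]_n) : Prop :=
  exists (p d : nat) (M : set 'rV[R]_(n + p + d)), induces_binary_MICP M S.

Definition union_of_projections (R : realType) (n q d : nat)
    (S : set 'rV[R]_n) (St : 'I_d -> set 'rV[R]_(n + q)) : Prop :=
  (forall i, [/\ St i !=set0, closed (St i) & convex_set (St i)]) /\
  S = \bigcup_i (lsubmx @` St i).

(* {(w, w0) | w in A, ||w||_2^2 <= w0} *)
Definition paraboloid_lift (R : realType) (m : nat) (A : set 'rV[R]_m) :
    set 'rV[R]_(m + 1) :=
  [set u | A (lsubmx u) /\ sqnorm2 (lsubmx u) <= rsubmx u 0 0].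

(* The identification of (w, w0) in R^((n + q) + 1) with (x, y) in
   R^(n + (q + 1)); the coordinates are unchanged (see row_mxA). *)
Definition regroup (R : realType) (n q : nat) (u : 'rV[R]_(n + q + 1)) :
    'rV[R]_(n + (q + 1)) :=
  castmx (erefl 1, esym (addnA n q 1)) u.

Definition Tset (R : realType) (n q : nat) (A : set 'rV[R]_(n + q)) :
    set 'rV[R]_(n + (q + 1)) :=
  @regroup R n q @` paraboloid_lift A.

(* delta_mx 0 i is the unit vector e(d, i); i ranges over 0, ..., d - 1 *)
Definition Mset (R : realType) (n q d : nat)
    (St : 'I_d -> set 'rV[R]_(n + q)) : set 'rV[R]_(n + (q + 1) + d) :=
  conv_hull (\bigcup_i [set row_mx t (delta_mx 0 i) | t in Tset (St i)]).

(* Main.v *)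
From HB Require Import structures.
Require Import Defs.
From mathcomp Require Import all_boot all_order all_algebra.
From mathcomp Require Import all_classical all_reals all_analysis.
From mathcomp Require Import ring lra.

Set Implicit Arguments.
Unset Strict Implicit.
Unset Printing Implicit Defensive.

Import Order.TTheory GRing.Theory Num.Theory.
Import numFieldNormedType.Exports.

Local Open Scope classical_set_scope.
Local Open Scope ring_scope.

(** A binary formulation [M] of [S] is cut by the finitely many planes [z = b],
    [b] a 0/1 vector, into closed convex slices, and [S] is the union of the
    projections of the nonempty ones ([binary_MICP_union]).

    In the other direction the difficulty is that the convex hull of a finite
    union of unbounded closed convex sets need not be closed: a sequence of
    convex combinations may have points that escape to infinity while their
    weights tend to 0, and leave a recession direction in the limit.  The
    constraint [||w||^2 <= w0] leaves the vertical direction as the only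
    possible one, and moving up keeps a point in the lifted set.

    To turn this into a proof, a weighted point [z * (w, w0)] of the lift of
    [A] is recorded by [v = z * w], [c = z * w0] and [z]; the triples that arise
    are those with [||v||^2 <= c * z] and [v / z] in [A] for [z > 0].  Where
    [z = 0], the inequality forces [v = 0] and leaves [c >= 0] free, which is
    the vertical direction.  So this set, [perspective A], is a closed convex
    cone ([perspective_closed], [perspectiveZ], [perspectiveD]), and the hull
    is the image under a linear map of the families of such triples whose
    weights add up to 1 ([conv_hull_lift_pieces]).  A bound on the last
    coordinate [\sum c_i] of the image bounds every [c_i], [z_i] and [v_i], so
    the part of the hull below any given height is the image of a compact set,
    and the hull is closed ([assemble_decomposition_closed]).

    Since weights are nonnegative and sum to 1, integral weights are a unit
    vector [e_i]; then all [v_j] with [j <> i] vanish, and the point lies over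
    the [i]-th piece ([integer_decomposition]).  Hence the hull adds no point to
    the projection. *)

(** * Convex combinations, continuity and compactness *)

Lemma convex_setP (R : realType) (V : lmodType R) (C : set V) :
  convex_set C <->
  forall (x y : V) (t : R), 0 <= t -> t <= 1 -> C x -> C y ->
    C (t *: x + (1 - t) *: y).
Proof.
split=> [cC x y t t0 t1 /mem_set Cx /mem_set Cy|].
  exact: set_mem (cC x y (Itv01 t0 t1) Cx Cy).
by move=> cC x y l /set_mem Cx /set_mem Cy; apply/mem_set/cC.
Qed.

(** The weights are normalised in the statement so that the induction on [s] can
    apply to a tail whose weights do not sum to 1. *)
Lemma convex_combination (R : realType) (V : lmodType R) (C : set V)
    (I : eqType) (s : seq I) (a : I -> R) (x : I -> V) :
    convex_set C -> (forall i, 0 <= a i) -> (forall i, 0 < a i -> C (x i)) ->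
  0 < \sum_(i <- s) a i ->
  C ((\sum_(i <- s) a i)^-1 *: \sum_(i <- s) a i *: x i).
Proof.
move=> /convex_setP cC a0 Cx; elim: s => [|i s IH].
  by rewrite big_nil ltxx.
rewrite !big_cons; set A := \sum_(j <- s) a j; set X := \sum_(j <- s) _ => ap.
have A0 : 0 <= A by apply: sumr_ge0.
have [ai0|ai0] := eqVneq (a i) 0.
  by rewrite ai0 scale0r !add0r; apply: IH; move: ap; rewrite ai0 add0r.
have aip : 0 < a i by rewrite lt_def ai0 a0.
have [AE|An0] := eqVneq A 0.
  have -> : X = 0.
    rewrite /X big_seq; apply: big1 => j js.
    suff -> : a j = 0 by rewrite scale0r.
    apply/eqP; rewrite eq_le a0 andbT -AE /A (big_rem j js) /=.
    by rewrite lerDl sumr_ge0.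
  by rewrite AE !addr0 scalerA mulVf// scale1r; apply: Cx.
have Ap : 0 < A by rewrite lt_def An0 A0.
have -> : (a i + A)^-1 *: (a i *: x i + X) =
    (a i / (a i + A)) *: x i + (1 - a i / (a i + A)) *: (A^-1 *: X).
  rewrite scalerDr !scalerA [_^-1 * a i]mulrC; congr (_ + _ *: _).
  by field; rewrite An0 gt_eqF.
apply: cC; [by rewrite divr_ge0// ltW|..|exact: Cx|exact: IH].
by rewrite ler_pdivrMr// mul1r lerDl.
Qed.

Lemma sum_continuous (R : realType) (T : topologicalType) (V : normedModType R)
    (I : finType) (f : I -> T -> V) :
  (forall i, continuous (f i)) -> continuous (fun x => \sum_i f i x).
Proof. by move=> cf; apply: continuous_big => //; exact: add_continuous. Qed.

(** A linear map is a combination of the coordinate functions, by its values on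
    the matrices [delta_mx i j]. *)
Lemma linear_mx_continuous (R : realType) (m n : nat) (V : normedModType R)
    (f : 'M[R]_(m, n) -> V) : linear f -> continuous f.
Proof.
move=> lf.
pose g : {linear 'M[R]_(m, n) -> V} :=
  HB.pack f (GRing.isLinear.Build _ _ _ _ f lf).
have -> : f = fun M => \sum_i \sum_j M i j *: g (delta_mx i j).
  apply/funext => M; rewrite -[f]/(g : _ -> _) {1}[M]matrix_sum_delta linear_sum.
  apply: eq_bigr => i _; rewrite linear_sum.
  by apply: eq_bigr => j _; rewrite linearZ.
apply: sum_continuous => i; apply: sum_continuous => j M.
by apply: cvgZr_tmp; [exact: nbhs_filter|exact: coord_continuous].
Qed.

(** Heine-Borel for matrices, deduced from the case of row vectors through
    [vec_mx]. *)
Lemma closed_coord_bounded_compact (R : realType) (m n : nat)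
    (A : set 'M[R]_(m, n)) (B : R) :
  closed A -> (forall M i j, A M -> `|M i j| <= B) -> compact A.
Proof.
move=> cA bA.
have cv : continuous (@vec_mx R m n).
  by apply: linear_mx_continuous => a u v; rewrite linearP.
have -> : A = vec_mx @` (@vec_mx R m n @^-1` A).
  apply/seteqP; split=> [M AM|_ [u Au <-]//].
  by exists (mxvec M); rewrite /= ?mxvecK.
apply: continuous_compact; first exact: continuous_subspaceT.
have -> : @vec_mx R m n @^-1` A = (@vec_mx R m n @^-1` A) `&`
   [set u : 'rV[R]_(m * n) | forall k, `[- B, B]%classic (u 0 k)].
  apply/seteqP; split=> [u Au|u []//]; split => // k.
  case/mxvec_indexP: k => i j.
  by rewrite -[u]vec_mxK mxvecE /= in_itv /= -ler_norml; apply: bA.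
rewrite setIC; apply: compact_closedI; last by apply: preimage_closed => // x _.
by apply: (@rV_compact _ _ (fun=> `[- B, B]%classic)) => _; exact: segment_compact.
Qed.

(** Closedness is a local property, and the open sets [h < r] cover [T]. *)
Lemma closed_sublevels (R : realType) (T : topologicalType) (h : T -> R)
    (C : set T) :
  continuous h -> (forall r, closed (C `&` [set x | h x <= r])) -> closed C.
Proof.
move=> ch cC x clx.
suff [] : (C `&` [set y | h y <= h x + 1]) x by [].
apply: (cC (h x + 1)) => B nB.
have nh : nbhs x (h @^-1` [set y | y < h x + 1]).
  by apply: (ch x); have := @lt_nbhsl R (h x) (h x + 1); apply; rewrite ltrDl.
have [y [Cy [By hy]]] := clx _ (filterI nB nh).
by exists y; split=> //; split=> //; apply: ltW.
Qed.

(** * The perspective cone over a convex set *)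

Lemma sqnorm2_ge0 (R : realType) (m : nat) (v : 'rV[R]_m) : 0 <= sqnorm2 v.
Proof. by apply: sumr_ge0 => j _; apply: sqr_ge0. Qed.

Lemma sqnorm2_le0 (R : realType) (m : nat) (v : 'rV[R]_m) :
  sqnorm2 v <= 0 -> v = 0.
Proof.
move=> v0; have /psumr_eq0P E : sqnorm2 v = 0.
  by apply/eqP; rewrite eq_le v0 sqnorm2_ge0.
apply/rowP => j; rewrite mxE; apply/eqP; rewrite -sqrf_eq0; apply/eqP.
by apply: E => // k _; apply: sqr_ge0.
Qed.

Lemma sqnorm2Z (R : realType) (m : nat) (t : R) (v : 'rV[R]_m) :
  sqnorm2 (t *: v) = t ^+ 2 * sqnorm2 v.
Proof.
by rewrite /sqnorm2 mulr_sumr; apply: eq_bigr => j _; rewrite mxE exprMn.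
Qed.

(** This is joint convexity of [(v, z) |-> ||v||^2 / z] in homogeneous form;
    in each coordinate the gap is [(z' x - z y)^2 / (z z')]. *)
Lemma sqnorm2D (R : realType) (m : nat) (v v' : 'rV[R]_m) (z z' : R) :
    0 < z -> 0 < z' ->
  sqnorm2 (v + v') <= (z + z') * (sqnorm2 v / z + sqnorm2 v' / z').
Proof.
move=> z0 z'0; rewrite /sqnorm2 !mulr_suml -big_split mulr_sumr /=.
apply: ler_sum => j _; rewrite mxE -subr_ge0.
set x := v 0 j; set y := v' 0 j.
have -> : (z + z') * (x ^+ 2 / z + y ^+ 2 / z') - (x + y) ^+ 2 =
    (z' * x - z * y) ^+ 2 / (z * z').
  by field; rewrite !gt_eqF.
by rewrite divr_ge0 ?sqr_ge0// mulr_ge0// ltW.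
Qed.

Lemma sqnorm2_continuous (R : realType) (m : nat) :
  continuous (@sqnorm2 R m).
Proof.
apply: (@sum_continuous R _ R^o) => j v; under eq_fun do rewrite expr2.
exact: cvgM (@coord_continuous _ _ _ 0 j v) (@coord_continuous _ _ _ 0 j v).
Qed.

Lemma coord_sqnorm2 (R : realType) (m : nat) (v : 'rV[R]_m) (r : R) j :
  sqnorm2 v <= r -> `|v 0 j| <= r + 1.
Proof.
move=> vr; have : v 0 j ^+ 2 <= r.
  apply: le_trans vr; rewrite /sqnorm2 (bigD1 j)//= lerDl.
  by apply: sumr_ge0 => k _; apply: sqr_ge0.
rewrite -real_normK ?num_real//; have := normr_ge0 (v 0 j).
by set a := `|_|; nra.
Qed.

(** The closed cone generated by the points [(w, w0, 1)] with [w] in [A] and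
    [||w||^2 <= w0], for nonempty closed convex [A]: [(v, c, z)] stands for [z] times the
    point [(v / z, c / z)] of the paraboloid lift.  The points with [z = 0] are
    the vertical recession directions [(0, c, 0)]. *)
Definition perspective (R : realType) (m : nat) (A : set 'rV[R]_m)
    (v : 'rV[R]_m) (c z : R) : Prop :=
  [/\ 0 <= z, 0 <= c, sqnorm2 v <= c * z & 0 < z -> A (z^-1 *: v)].

Lemma perspective0 (R : realType) (m : nat) (A : set 'rV[R]_m) v c :
  perspective A v c 0 -> v = 0.
Proof. by case=> _ _; rewrite mulr0 => /sqnorm2_le0. Qed.

Lemma perspectiveZ (R : realType) (m : nat) (A : set 'rV[R]_m) v c z (t : R) :
  0 <= t -> perspective A v c z -> perspective A (t *: v) (t * c) (t * z).
Proof.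
move=> t0 [z0 c0 vc Av]; split; rewrite ?mulr_ge0//.
  by rewrite sqnorm2Z mulrACA ler_wpM2l// mulr_ge0.
move=> tz; have tp : 0 < t.
  by rewrite lt_def t0 andbT; apply: contraTneq tz => ->; rewrite mul0r ltxx.
rewrite scalerA.
have -> : (t * z)^-1 * t = z^-1 by rewrite invfM mulrAC mulVf ?mul1r// gt_eqF.
by apply: Av; rewrite -(pmulr_rgt0 _ tp).
Qed.

Lemma perspectiveD (R : realType) (m : nat) (A : set 'rV[R]_m) v c z v' c' z' :
    convex_set A -> perspective A v c z -> perspective A v' c' z' ->
  perspective A (v + v') (c + c') (z + z').
Proof.
move=> /convex_setP cA; move=> p p'.
have [z0 c0 vc Av] := p; have [z'0 c'0 vc' Av'] := p'.
have [zE|zn0] := eqVneq z 0.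
  move: p; rewrite zE => /perspective0 ->; rewrite !add0r.
  by split; rewrite ?addr_ge0// (le_trans vc')// mulrDl lerDr mulr_ge0.
have [z'E|z'n0] := eqVneq z' 0.
  move: p'; rewrite z'E => /perspective0 ->; rewrite !addr0.
  by split; rewrite ?addr_ge0// (le_trans vc)// mulrDl lerDl mulr_ge0.
have zp : 0 < z by rewrite lt_def zn0.
have z'p : 0 < z' by rewrite lt_def z'n0.
split; rewrite ?addr_ge0//.
  apply: le_trans (sqnorm2D v v' zp z'p) _.
  by rewrite mulrC ler_wpM2r ?addr_ge0// lerD// ler_pdivrMr.
move=> s0; have sn0 : z + z' != 0 by rewrite gt_eqF.
have -> : (z + z')^-1 *: (v + v') = (z / (z + z')) *: (z^-1 *: v) +
    (1 - z / (z + z')) *: (z'^-1 *: v').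
  by rewrite scalerDr !scalerA; congr (_ *: _ + _ *: _); field; rewrite ?zn0 ?z'n0.
apply: cA; [by rewrite divr_ge0// ltW|..|exact: Av|exact: Av'].
by rewrite ler_pdivrMr// mul1r lerDl.
Qed.

(** Membership of [v / z] in [A] is demanded only where [z > 0], an open
    condition under which [v / z] is continuous; at a limit point with [z = 0]
    only the closed inequalities have to hold. *)
Lemma perspective_closed (R : realType) (m : nat) (A : set 'rV[R]_m)
    (T : topologicalType) (v : T -> 'rV[R]_m) (c z : T -> R) :
    closed A -> continuous v -> continuous c -> continuous z ->
  closed [set x | perspective A (v x) (c x) (z x)].
Proof.
move=> cA cv cc cz x clx.
have lim (D : set R) (f : T -> R) : closed D -> continuous f ->
    (forall y, perspective A (v y) (c y) (z y) -> D (f y)) -> D (f x).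
  move=> cD cf fD; suff : (f @^-1` D) x by [].
  by apply: preimage_closed => //; apply: closureS clx.
split.
- by apply: (lim [set t | 0 <= t] z (@closed_ge _ 0) cz) => y [].
- by apply: (lim [set t | 0 <= t] c (@closed_ge _ 0) cc) => y [].
- rewrite -subr_ge0.
  apply: (lim [set t | 0 <= t] (fun y => c y * z y - sqnorm2 (v y))).
  + exact: closed_ge.
  + move=> y; apply: cvgB; first by apply: cvgM; [exact: cc|exact: cz].
    exact: (continuous_comp (cv y) (@sqnorm2_continuous _ _ _)).
  + by move=> y [_ _ h _]; rewrite /= subr_ge0.
- move=> zx; apply: cA => B nB.
  have cw : {for x, continuous (fun y => (z y)^-1 *: v y)}.
    apply: cvgZ; last exact: cv.
    by apply: cvgV; [rewrite gt_eqF|exact: cz].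
  have nz : nbhs x (z @^-1` [set t | 0 < t]).
    by apply: (cz x); have := @lt_nbhsr R 0 (z x); apply.
  have nwB : nbhs x ((fun y => (z y)^-1 *: v y) @^-1` B) by exact: cw.
  have [y [[_ _ _ Ay] [By zy]]] := clx _ (filterI nwB nz).
  by exists ((z y)^-1 *: v y); split; [exact: Ay|].
Qed.

(** * The convex hull of the lifted pieces *)

Lemma perspective_apex (R : realType) (m : nat) (A : set 'rV[R]_m) :
  perspective A 0 0 0.
Proof.
split=> //; last by rewrite ltxx.
by rewrite mul0r /sqnorm2 big1// => j _; rewrite mxE expr0n.
Qed.

Lemma perspective1 (R : realType) (m : nat) (A : set 'rV[R]_m) v c :
  A v -> sqnorm2 v <= c -> perspective A v c 1.
Proof.
move=> Av vc; split=> //; rewrite ?mulr1 ?invr1 ?scale1r//.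
exact: le_trans (sqnorm2_ge0 v) vc.
Qed.

(** Row [i] of [P] is a triple [(v_i, c_i, z_i)].  Packing the rows into one
    matrix makes compactness and continuity statements about matrices. *)
Definition decomposition (R : realType) (m d : nat)
    (A : 'I_d -> set 'rV[R]_m) : set 'M[R]_(d, m + 1 + 1) :=
  [set P | (forall i, perspective (A i) (row i (lsubmx (lsubmx P)))
                        (rsubmx (lsubmx P) i 0) (rsubmx P i 0)) /\
           \sum_i rsubmx P i 0 = 1].

Definition assemble (R : realType) (m d : nat) (P : 'M[R]_(d, m + 1 + 1)) :
    'rV[R]_(m + 1 + d) :=
  row_mx (\sum_i row i (lsubmx P)) (rsubmx P)^T.
Arguments assemble {R m d} P.

Lemma assemble_linear (R : realType) (m d : nat) :
  linear (@assemble R m d).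
Proof.
move=> a P Q; rewrite /assemble scale_row_mx add_row_mx; congr row_mx.
  rewrite scaler_sumr -big_split; apply: eq_bigr => i _.
  by rewrite /= !linearP.
by rewrite !linearP.
Qed.

HB.instance Definition _ (R : realType) (m d : nat) :=
  GRing.isLinear.Build R _ _ _ (@assemble R m d) (@assemble_linear R m d).

Lemma decomposition_convex (R : realType) (m d : nat)
    (A : 'I_d -> set 'rV[R]_m) :
  (forall i, convex_set (A i)) -> convex_set (decomposition A).
Proof.
move=> cA; apply/convex_setP => P Q t t0 t1 [pP sP] [pQ sQ].
have t1' : 0 <= 1 - t by rewrite subr_ge0.
split.
  move=> i.
  have := perspectiveD (cA i) (perspectiveZ t0 (pP i)) (perspectiveZ t1' (pQ i)).
  by rewrite !linearD !linearZ/= !mxE.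
rewrite (eq_bigr (fun i => t * rsubmx P i 0 + (1 - t) * rsubmx Q i 0)).
  by rewrite big_split -!mulr_sumr /= sP sQ; ring.
by move=> i _; rewrite !mxE.
Qed.

Definition lift_pieces (R : realType) (m d : nat) (A : 'I_d -> set 'rV[R]_m) :
    set 'rV[R]_(m + 1 + d) :=
  \bigcup_i [set row_mx t (delta_mx 0 i) | t in paraboloid_lift (A i)].

(** A point of the [i]-th piece is assembled from the family with this point,
    weighted 1, in row [i] and the apex of the cone in all other rows. *)
Lemma lift_pieces_sub (R : realType) (m d : nat) (A : 'I_d -> set 'rV[R]_m) :
  lift_pieces A `<=` assemble @` decomposition A.
Proof.
move=> _ [i _ [t [At nt] <-]].
pose D : 'cV[R]_d := delta_mx i 0.
exists (row_mx (D *m t) D).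
  have DE k : D k 0 = (k == i)%:R by rewrite mxE eqxx andbT.
  have rowD k p (w : 'rV[R]_p) : row k (D *m w) = (k == i)%:R *: w.
    by apply/rowP => j; rewrite !mxE big_ord1 DE.
  have DtE k : (rsubmx (D *m t)) k 0 = (k == i)%:R * rsubmx t 0 0.
    by rewrite !mxE big_ord1 DE.
  split=> [k|]; rewrite row_mxKr ?row_mxKl.
    rewrite DtE DE -[t in lsubmx (D *m t)]hsubmxK mul_mx_row row_mxKl rowD.
    have [->|_] := eqVneq k i; last first.
      by rewrite scale0r mul0r; exact: perspective_apex.
    by rewrite scale1r mul1r; apply: perspective1.
  rewrite (bigD1 i)//= DE eqxx big1 ?addr0// => k ki.
  by rewrite DE (negbTE ki).
rewrite /assemble row_mxKl row_mxKr; congr row_mx; last by rewrite /D trmx_delta.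
rewrite (bigD1 i)//= big1 ?addr0 => [|k ki].
  by apply/rowP => j; rewrite !mxE big_ord1 !mxE !eqxx mul1r.
by apply/rowP => j; rewrite !mxE big_ord1 !mxE (negbTE ki) mul0r.
Qed.

(** The rows with [z_i = 0] are not multiples of points of a piece.  They
    contribute only height, and each point of a lift may be raised, so the total
    excess [s] of the heights [c_i] over the least possible [z_i * ||w_i||^2] is
    added to the height of every [w_i]; as the weights sum to 1, the total
    height is again [\sum_i c_i]. *)
Lemma assemble_sub_conv_hull (R : realType) (m d : nat)
    (A : 'I_d -> set 'rV[R]_m) :
  assemble @` decomposition A `<=` conv_hull (lift_pieces A).
Proof.
move=> _ [P [pP sP] <-] C [cC genC].
pose z i := rsubmx P i 0; pose c i := rsubmx (lsubmx P) i 0.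
pose v i := row i (lsubmx (lsubmx P)); pose w i := (z i)^-1 *: v i.
pose s := \sum_i (c i - z i * sqnorm2 (w i)).
pose t i : 'rV[R]_(m + 1) := row_mx (w i) (const_mx (sqnorm2 (w i) + s)).
(* At [z i = 0] the cone has [v i = 0], so dividing by [z i] loses nothing. *)
have zw i : z i *: w i = v i.
  have [z0|zn0] := eqVneq (z i) 0; last by rewrite /w scalerA mulfV// scale1r.
  have := pP i; rewrite -/(z i) -/(v i) z0 => /perspective0 ->.
  by rewrite scale0r.
have s0 : 0 <= s.
  apply: sumr_ge0 => i _; rewrite subr_ge0.
  have [] := pP i; rewrite -/(z i) -/(v i) -/(c i) => z0 c0 vc _.
  have [zE|zn0] := eqVneq (z i) 0; first by rewrite zE mul0r.
  have zp : 0 < z i by rewrite lt_def zn0.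
  rewrite /w sqnorm2Z expr2 !mulrA mulfV// mul1r mulrC.
  by rewrite ler_pdivrMr.
have -> : assemble P =
    (\sum_i z i)^-1 *: \sum_i z i *: row_mx (t i) (delta_mx 0 i).
  rewrite [\sum_i z i]sP invr1 scale1r -[RHS]hsubmxK; congr row_mx; last first.
    rewrite linear_sum [LHS]row_sum_delta; apply: eq_bigr => i _.
    by rewrite linearZ/= row_mxKr mxE.
  rewrite linear_sum.
  under [RHS]eq_bigr do rewrite linearZ/= row_mxKl.
  rewrite -[LHS]hsubmxK -[RHS]hsubmxK; congr row_mx.
    rewrite !linear_sum; apply: eq_bigr => i _.
    rewrite linearZ/= row_mxKl zw.
    by apply/rowP => j; rewrite !mxE.
  apply/rowP => j; rewrite ord1 !mxE !summxE.
  rewrite [RHS](eq_bigr (fun i => z i * sqnorm2 (w i) + z i * s)); last first.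
    by move=> i _; rewrite mxE row_mxEr mxE mulrDr.
  rewrite big_split /= -mulr_suml [\sum_i z i]sP mul1r /s -big_split /=.
  by apply: eq_bigr => i _; rewrite [RHS]addrC subrK /c !mxE.
apply: convex_combination => // [i|i zi|]; first by have [] := pP i.
  2: by rewrite [X in 0 < X]sP.
apply: genC; exists i => //; exists (t i) => //.
split; rewrite ?row_mxKl ?row_mxKr.
  by have [_ _ _] := pP i; apply.
by rewrite mxE lerDl.
Qed.

Lemma conv_hull_lift_pieces (R : realType) (m d : nat)
    (A : 'I_d -> set 'rV[R]_m) :
  (forall i, convex_set (A i)) ->
  conv_hull (lift_pieces A) = assemble @` decomposition A.
Proof.
move=> cA; apply/seteqP; split; last exact: assemble_sub_conv_hull.
apply: smallest_sub; last exact: lift_pieces_sub.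
apply/convex_setP => _ _ t t0 t1 [P dP <-] [Q dQ <-].
have /convex_setP cD := decomposition_convex cA.
exists (t *: P + (1 - t) *: Q); first exact: cD.
by rewrite linearD !linearZ.
Qed.

(** * Closedness of the hull and its integer points *)

Lemma decomposition_closed (R : realType) (m d : nat)
    (A : 'I_d -> set 'rV[R]_m) :
  (forall i, closed (A i)) -> closed (decomposition A).
Proof.
move=> cA.
have cc i : continuous (fun P : 'M[R]_(d, m + 1 + 1) => rsubmx (lsubmx P) i 0).
  by apply: (@linear_mx_continuous R _ _ R^o) => a u v; rewrite !linearP !mxE.
have cz i : continuous (fun P : 'M[R]_(d, m + 1 + 1) => rsubmx P i 0).
  by apply: (@linear_mx_continuous R _ _ R^o) => a u v; rewrite linearP !mxE.
have -> : decomposition A =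
    \bigcap_i [set P | perspective (A i) (row i (lsubmx (lsubmx P)))
                        (rsubmx (lsubmx P) i 0) (rsubmx P i 0)] `&`
    (fun P : 'M[R]_(d, m + 1 + 1) => \sum_i rsubmx P i 0) @^-1` [set 1].
  by apply/seteqP; split=> P [dP sP]; split=> // i; [move=> _; exact: dP|exact: dP].
apply: closedI.
  apply: closed_bigI => i _; apply: perspective_closed => //.
  by apply: linear_mx_continuous => a u v; rewrite !linearP.
apply: preimage_closed; last exact: closed_eq.
by move=> P _; apply: (@sum_continuous R _ R^o).
Qed.

(** Below height [r] the families [P] have bounded entries: [0 <= z_i <= 1],
    [0 <= c_i <= r] and [||v_i||^2 <= c_i * z_i <= r]. *)
Lemma assemble_decomposition_closed (R : realType) (m d : nat)
    (A : 'I_d -> set 'rV[R]_m) :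
  (forall i, closed (A i)) -> closed (assemble @` decomposition A).
Proof.
move=> cA.
pose h (X : 'rV[R]_(m + 1 + d)) : R := rsubmx (lsubmx X) 0 0.
have ch : continuous h.
  by apply: (@linear_mx_continuous R _ _ R^o) => a u v; rewrite /h !linearP !mxE.
have ca : continuous (@assemble R m d).
  by apply: linear_mx_continuous => a u v; rewrite linearP.
have hE P : h (assemble P) = \sum_i rsubmx (lsubmx P) i 0.
  by rewrite /h /assemble row_mxKl mxE summxE; apply: eq_bigr => i _; rewrite !mxE.
apply: (@closed_sublevels R _ h) => // r.
have -> : assemble @` decomposition A `&` [set X | h X <= r] =
    assemble @` (decomposition A `&` (h \o assemble) @^-1` [set t | t <= r]).
  apply/seteqP; split=> [_ [[P dP <-] hr]|_ [P [dP hr] <-]]; first by exists P.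
  by split=> //; exists P.
apply: compact_closed; first exact: norm_hausdorff.
apply: continuous_compact; first exact: continuous_subspaceT.
apply: (@closed_coord_bounded_compact R _ _ _ (`|r| + 1)).
  apply: closedI; first exact: decomposition_closed.
  apply: preimage_closed; last exact: closed_le.
  by move=> P _; apply: continuous_comp; [exact: ca|exact: ch].
move=> P i j [[pP sP]]; rewrite /= hE => hr.
have zi0 k : 0 <= rsubmx P k 0 by have [] := pP k.
have ci0 k : 0 <= rsubmx (lsubmx P) k 0 by have [] := pP k.
have z1 : rsubmx P i 0 <= 1.
  by rewrite -sP (bigD1 i)//= lerDl sumr_ge0.
have cr : rsubmx (lsubmx P) i 0 <= `|r|.
  apply: le_trans (le_trans hr (ler_norm r)).
  by rewrite (bigD1 i)//= lerDl sumr_ge0.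
have r1 : 0 <= `|r| by [].
have [_ _ vc _] := pP i.
rewrite -[P]hsubmxK; case: (split_ordP j) => k ->; last first.
  by rewrite row_mxEr ord1 ger0_norm//; lra.
rewrite row_mxEl -[lsubmx P]hsubmxK; case: (split_ordP k) => l ->; last first.
  by rewrite row_mxEr ord1 ger0_norm//; lra.
rewrite row_mxEl.
have -> : lsubmx (lsubmx P) i l = row i (lsubmx (lsubmx P)) 0 l by rewrite [RHS]mxE.
apply: coord_sqnorm2; apply: le_trans vc _.
by rewrite -[leRHS]mulr1 ler_pM.
Qed.

Lemma integer_decomposition (R : realType) (m d : nat)
    (A : 'I_d -> set 'rV[R]_m) (P : 'M[R]_(d, m + 1 + 1)) :
    decomposition A P -> integer_vec (rsubmx (assemble P)) ->
  exists i, rsubmx (assemble P) = delta_mx 0 i /\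
            A i (lsubmx (lsubmx (assemble P))).
Proof.
rewrite /assemble row_mxKl row_mxKr => -[pP sP] intP.
pose z i := rsubmx P i 0.
have z0 i : 0 <= z i by have [] := pP i.
have [i zi0] : exists i, z i != 0.
  apply/existsP; rewrite -negb_forall; apply/negP => /forallP zz.
  have := sP; rewrite big1 => [/eqP|k _]; first by rewrite eq_sym oner_eq0.
  exact/eqP/zz.
have s1 : z i + \sum_(k | k != i) z k = 1 by rewrite -[RHS]sP [RHS](bigD1 i).
have zi1 : 1 <= z i.
  rewrite -[z i]ger0_norm//; apply: norm_intr_ge1 => //.
  by have := intP i; rewrite mxE.
have rest0 : \sum_(k | k != i) z k = 0.
  apply/eqP; rewrite eq_le sumr_ge0// andbT.
  by move: s1 zi1; lra.
have zi : z i = 1 by move: s1; rewrite rest0 addr0.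
have zk k : k != i -> z k = 0.
  by move=> ki; apply: (psumr_eq0P _ rest0).
exists i; split.
  apply/rowP => k; rewrite mxE [RHS]mxE eqxx/= -/(z k).
  by have [->|/zk] := eqVneq k i.
have -> : lsubmx (\sum_k row k (lsubmx P)) = row i (lsubmx (lsubmx P)).
  rewrite linear_sum (bigD1 i)//= big1 ?addr0 => [|k ki].
    by apply/rowP => j; rewrite !mxE.
  have := pP k; rewrite -/(z k) (zk _ ki) => /perspective0 <-.
  by apply/rowP => j; rewrite !mxE.
by have [_ _ _] := pP i; rewrite -/(z i) zi invr1 scale1r; apply; exact: ltr01.
Qed.

Lemma conv_hull_convex (R : realType) (k : nat) (A : set 'rV[R]_k) :
  convex_set (conv_hull A).
Proof.
apply/convex_setP => x y t t0 t1 Ax Ay C CA.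
have [/convex_setP cC _] := CA.
by apply: cC => //; [exact: Ax|exact: Ay].
Qed.

(** [Mset] regroups the coordinates of its first block along an equality of
    dimensions.  For an arbitrary equality [e : m = k] this regrouping becomes
    the identity after elimination of [e]. *)
Definition cast_left (R : realType) (m k d : nat) (e : m = k)
    (X : 'rV[R]_(m + d)) : 'rV[R]_(k + d) :=
  row_mx (castmx (erefl 1, e) (lsubmx X)) (rsubmx X).

Lemma cast_left_id (R : realType) (m d : nat) :
  @cast_left R m m d erefl = id.
Proof. by apply/funext => X; rewrite /cast_left castmx_id hsubmxK. Qed.

Lemma cast_left_closed (R : realType) (m k d : nat) (e : m = k)
    (C : set 'rV[R]_(m + d)) :
  closed C -> closed (cast_left e @` C).
Proof. by case: k / e; rewrite cast_left_id image_id. Qed.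

Lemma conv_hull_cast (R : realType) (m k d : nat) (e : m + 1 = k)
    (A : 'I_d -> set 'rV[R]_m) :
  conv_hull (\bigcup_i [set row_mx t (delta_mx 0 i) |
                t in castmx (erefl 1, e) @` paraboloid_lift (A i)]) =
  cast_left e @` conv_hull (lift_pieces A).
Proof.
case: k / e; rewrite cast_left_id image_id; congr conv_hull.
apply: eq_bigcup => // i _ /=; congr image.
rewrite -[RHS]image_id; apply: eq_imagel => u _ /=.
by rewrite castmx_id.
Qed.

Lemma MsetE (R : realType) (n q d : nat) (St : 'I_d -> set 'rV[R]_(n + q)) :
    (forall i, convex_set (St i)) ->
  Mset St = cast_left (esym (addnA n q 1)) @` (assemble @` decomposition St).
Proof.
by move=> cS; rewrite -conv_hull_lift_pieces// -conv_hull_cast.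
Qed.

Lemma regroupE (R : realType) (n q : nat) (u : 'rV[R]_(n + q + 1)) :
  regroup u = row_mx (lsubmx (lsubmx u)) (row_mx (rsubmx (lsubmx u)) (rsubmx u)).
Proof. by rewrite row_mxA !hsubmxK. Qed.

Lemma Mset_integer_slice (R : realType) (n q d : nat)
    (St : 'I_d -> set 'rV[R]_(n + q)) (x : 'rV[R]_n) (y : 'rV[R]_(q + 1))
    (z : 'rV[R]_d) :
    (forall i, convex_set (St i)) -> integer_vec z ->
    Mset St (row_mx (row_mx x y) z) ->
  exists i, z = delta_mx 0 i /\ (lsubmx @` St i) x.
Proof.
move=> cS zint; rewrite MsetE// => -[_ [P dP <-]] /eq_row_mx[].
rewrite -/(regroup _) regroupE => /eq_row_mx[xE _] zE.
have [|i [iE Si]] := integer_decomposition dP; first by rewrite zE.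
by exists i; rewrite -zE; split=> //; exists (lsubmx (lsubmx (assemble P))).
Qed.

Lemma Mset_lift (R : realType) (n q d : nat)
    (St : 'I_d -> set 'rV[R]_(n + q)) (i : 'I_d) (w : 'rV[R]_(n + q)) :
  St i w ->
  Mset St (row_mx (row_mx (lsubmx w) (row_mx (rsubmx w) (const_mx (sqnorm2 w))))
             (delta_mx 0 i)).
Proof.
move=> Sw C [_]; apply; exists i => //.
eexists; last reflexivity.
exists (row_mx w (const_mx (sqnorm2 w))).
  by split; rewrite row_mxKl// row_mxKr mxE.
by rewrite regroupE row_mxKl row_mxKr.
Qed.

Lemma Mset_binary_MICP (R : realType) (n q d : nat) (S : set 'rV[R]_n)
    (St : 'I_d -> set 'rV[R]_(n + q)) :
  union_of_projections S St -> induces_binary_MICP (Mset St) S.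
Proof.
move=> [hS SE].
have cS i : convex_set (St i) by have [] := hS i.
have clS i : closed (St i) by have [] := hS i.
split; first split.
- by rewrite MsetE//; apply: cast_left_closed; apply: assemble_decomposition_closed.
- exact: conv_hull_convex.
- move=> x; rewrite SE; split=> [[i _ [w Sw <-]]|[y [z [zint Mx]]]].
    eexists; exists (delta_mx 0 i); split; last exact: Mset_lift Sw.
    by move=> j; rewrite mxE eqxx /= natr_int.
  by have [i [_ Sx]] := Mset_integer_slice cS zint Mx; exists i.
- move=> _ [X [MX intX] <-].
  move: MX; rewrite -[X]hsubmxK -[lsubmx X]hsubmxK.
  case/(Mset_integer_slice cS intX) => i [zE _].
  move=> j; rewrite row_mxKr zE mxE eqxx /=.
  by case: (j == i); [right|left].
Qed.

(** The pieces are the slices of [M] over the 0/1 vectors.  The empty ones are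
    discarded, since pieces have to be nonempty; all integer points of [M] are
    kept, as their last block is binary by hypothesis. *)
Lemma binary_MICP_union (R : realType) (n : nat) (S : set 'rV[R]_n) :
  binary_MICP_R S ->
  exists (q d : nat) (St : 'I_d -> set 'rV[R]_(n + q)),
    union_of_projections S St.
Proof.
move=> [p [d [M [[clM cM MS] binM]]]].
pose vec (b : {ffun 'I_d -> bool}) : 'rV[R]_d := \row_j (b j)%:R.
pose slice b : set 'rV[R]_(n + p) := [set w | M (row_mx w (vec b))].
pose B := [pred b | `[< slice b !=set0 >]].
have c0 : continuous (fun w : 'rV[R]_(n + p) => row_mx w (0 : 'rV[R]_d)).
  apply: linear_mx_continuous => a u v.
  by rewrite scale_row_mx add_row_mx scaler0 addr0.
exists p, #|B|, (fun i => slice (enum_val i)); split.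
  move=> i; split; first exact: asboolW (enum_valP i).
    apply: (@preimage_closed _ _ (fun w => row_mx w (vec (enum_val i)))) => // w _.
    have -> : (fun w : 'rV[R]_(n + p) => row_mx w (vec (enum_val i))) =
        (fun w => row_mx w 0 + row_mx 0 (vec (enum_val i))).
      by apply/funext => u; rewrite add_row_mx addr0 add0r.
    exact: cvgD (c0 w) (cvg_cst _).
  apply/convex_setP => u v t t0 t1 Mu Mv; rewrite /slice /=.
  move/convex_setP : cM => /(_ _ _ _ t0 t1 Mu Mv).
  by rewrite !scale_row_mx add_row_mx -scalerDl [t + _]addrC subrK scale1r.
apply/seteqP; split=> x.
  move=> /MS[y [z [zint Mx]]].
  have zb : binary_vec z.
    apply: binM; exists (row_mx (row_mx x y) z); last by rewrite row_mxKr.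
    by split=> //=; rewrite row_mxKr.
  pose b := [ffun j => z 0 j == 1].
  have zE : vec b = z.
    apply/rowP => j; rewrite mxE ffunE.
    by case: (zb j) => ->; rewrite ?eqxx// [0 == 1]eq_sym oner_eq0.
  have Sb : slice b (row_mx x y) by rewrite /slice /= zE.
  have Bb : b \in B by apply/asboolT; exists (row_mx x y).
  exists (enum_rank_in Bb b) => //; exists (row_mx x y); last by rewrite row_mxKl.
  by rewrite enum_rankK_in.
move=> [i _ [w Mw <-]]; apply/MS.
exists (rsubmx w), (vec (enum_val i)); rewrite hsubmxK; split=> // j.
by rewrite mxE natr_int.
Qed.

Theorem proposition4p2 (R : realType) (n : nat) (n_gt0 : (0 < n)%N)
    (S : set 'rV[R]_n) :
  (binary_MICP_R S <->
     exists (q d : nat) (St : 'I_d -> set 'rV[R]_(n + q)),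
       union_of_projections S St) /\
  (forall (q d : nat) (St : 'I_d -> set 'rV[R]_(n + q)),
     union_of_projections S St ->
     [/\ forall x : 'rV[R]_n, S x <->
           exists (y : 'rV[R]_(q + 1)) (z : 'rV[R]_d),
             integer_vec z /\ Mset St (row_mx (row_mx x y) z),
         closed (Mset St),
         convex_set (Mset St),
         rsubmx @` integer_slice (Mset St) `<=` @binary_vec R d &
         induces_binary_MICP (Mset St) S]).
Proof.
split.
  split; first exact: binary_MICP_union.
  move=> [q [d [St /Mset_binary_MICP bS]]].
  by exists (q + 1)%N, d, (Mset St).
move=> q d St /Mset_binary_MICP bS.
by have [[cl cv iff] bin] := bS; split.
Qed.
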